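(* Let $0<a<M$ and let $\mathcal{M}=\mathbb{R}_t\times(r_0,+\infty)\times\mathbb{S}^2$, $r_0=M+\sqrt{M^2-a^2}$, be the exterior of the subextremal Kerr black hole with mass $M$ and angular momentum per unit mass $a$. Let $\mathcal{N}_{0,r}\to\mathcal{M}$ be the $U(1)$ principal bundle defined in the context. There is no global continuous section of $\mathcal{N}_{0,r}$ (in other words, $\mathcal{N}_{0,r}$ is not the trivial bundle $U(1)\times\mathbb{R}_t\times(r_0,+\infty)\times\mathbb{S}^2$).
   Context: The Kerr metric on $\mathcal{M}$ (signature $(+,-,-,-)$, $(\theta,\phi)$ spherical coordinates on $\mathbb{S}^2$) is $$g=\left(1-\tfrac{2Mr}{\rho^2}\right)dt^2+\tfrac{4Mar\sin^2\theta}{\rho^2}dt\,d\phi-\tfrac{\rho^2}{\Delta_r}dr^2-\rho^2d\theta^2-\sin^2\theta\left(r^2+a^2+\tfrac{2Ma^2r\sin^2\theta}{\rho^2}\right)d\phi^2,$$ with $\Delta_r=r^2-2Mr+a^2$, $\rho^2=r^2+a^2\cos^2\theta$; it extends smoothly across the poles. It is Ricci-flat of Petrov type D, and the following global smooth vector fields are null, independent, and span the two principal null directions: $$l=\tfrac{r^2+a^2}{\Delta_r}\partial_t+\partial_r+\tfrac{a}{\Delta_r}\partial_\phi,\qquad n=\tfrac{r^2+a^2}{2\rho^2}\partial_t-\tfrac{\Delta_r}{2\rho^2}\partial_r+\tfrac{a}{2\rho^2}\partial_\phi .$$ The time orientation is such that $l,n$ are future oriented, and the space orientation is the one for which $(\partial_\theta,-\partial_\phi,\partial_r)$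 is positively oriented away from the axis. $g$ is extended $\mathbb{C}$-bilinearly to $T_{\mathbb{C}}\mathcal{M}$. $\mathcal{N}_{0,r}$ is the bundle of oriented Newman–Penrose null tetrads $(l',n',m)$ with $l'\in\mathbb{R}_+^*l$, $n'\in\mathbb{R}_+^*n$, modulo positive rescalings $(l',n',m)\mapsto(\lambda l',\lambda^{-1}n',m)$; it is identified with $$\mathcal{N}_{0,r}=\{m\in T_{\mathbb{C}}\mathcal{M}:\ g(m,m)=g(l,m)=g(n,m)=0,\ g(m,\overline{m})=-1,\ (l,n,m)\text{ oriented}\},$$ where $(l,n,m)$ oriented means that $\left(\frac{l+n}{\sqrt2},\Re(m),-\Im(m),\frac{l-n}{\sqrt2}\right)$ is an oriented basis (first vector future timelike, the other three spacelike with positively oriented spatial parts). $U(1)$ acts by $m\cdot e^{i\alpha}=e^{i\alpha}m$. *)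

(* Defs.v *)
From HB Require Import structures.
From mathcomp Require Import all_boot all_order all_algebra.
From mathcomp Require Import all_classical all_reals all_analysis.
From mathcomp Require Export complex.
From mathcomp Require Import ring.
Set Implicit Arguments.
Unset Strict Implicit.
Unset Printing Implicit Defensive.
Import Order.TTheory GRing.Theory Num.Theory.
Import numFieldNormedType.Exports.
Local Open Scope classical_set_scope.
Local Open Scope ring_scope.
Local Open Scope complex_scope.

(* The norm topology on the complex numbers R[i]. *)
HB.instance Definition _ (R : rcfType) := PseudoPointedMetric.copy R[i] R[i]^o.

(* The sphere S^2 is the unit sphere of R^3, with
   (theta, phi) |-> (sin theta cos phi, sin theta sin phi, cos theta).
   An event is ((t, r), w) with w in R^3; a (complex) tangent vector is
   ((dt, dr), v) with v in R^3 (C^3) orthogonal to w.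
   All topologies are induced by those of these ambient products. *)
Notation event R := (R * R * 'rV[R]_3)%type.
Notation tvector R := (R * R * 'rV[R]_3)%type.
Notation cvector R := (R[i] * R[i] * 'rV[R[i]]_3)%type.

Section Kerr.
Variable R : realType.
Implicit Types (M a : R) (x : event R) (u v e : tvector R) (m : cvector R).

Definition vec3 (a b c : R) : 'rV[R]_3 := \row_j [:: a; b; c]`_j.

Definition dot (v w : 'rV[R]_3) : R := \sum_i v 0 i * w 0 i.

Definition cos_theta x : R := x.2 0 (inord 2).

Definition outer_radius M a : R := M + Num.sqrt (M ^+ 2 - a ^+ 2).

Definition exterior M a : set (event R) :=
  [set x | outer_radius M a < x.1.2 /\ dot x.2 x.2 = 1].

Definition tangent x v : Prop := dot x.2 v.2 = 0.

Definition Delta M a x : R := x.1.2 ^+ 2 - 2 * M * x.1.2 + a ^+ 2.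

Definition rho2 a x : R := x.1.2 ^+ 2 + a ^+ 2 * cos_theta x ^+ 2.

Definition d_t : tvector R := (1, 0, 0).
Definition d_r : tvector R := (0, 1, 0).
Definition d_phi x : tvector R := (0, 0, vec3 (- x.2 0 (inord 1)) (x.2 0 (inord 0)) 0).

(* The one-form sin^2 theta dphi, which is smooth on the whole sphere. *)
Definition sin2_dphi x v : R := dot (d_phi x).2 v.2.

(* The smooth extension of the Kerr metric across the poles: since
   dtheta^2 + sin^2 theta dphi^2 is the metric induced by R^3 and
   r^2 + a^2 = rho^2 + a^2 sin^2 theta, the angular part of the metric is
   - rho^2 (dtheta^2 + sin^2 theta dphi^2)
   - a^2 (1 + 2 M r / rho^2) (sin^2 theta dphi)^2.
   See kerr_metric_spherical for the Boyer-Lindquist expression. *)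
Definition kerr_metric M a x u v : R :=
  let r := x.1.2 in let p := rho2 a x in
    (1 - 2 * M * r / p) * (u.1.1 * v.1.1)
  + 2 * M * a * r / p * (u.1.1 * sin2_dphi x v + v.1.1 * sin2_dphi x u)
  - p / Delta M a x * (u.1.2 * v.1.2)
  - p * dot u.2 v.2
  - a ^+ 2 * (1 + 2 * M * r / p) * (sin2_dphi x u * sin2_dphi x v).

Definition l_field M a x : tvector R :=
  ((x.1.2 ^+ 2 + a ^+ 2) / Delta M a x) *: d_t + d_r
  + (a / Delta M a x) *: d_phi x.

Definition n_field M a x : tvector R :=
  ((x.1.2 ^+ 2 + a ^+ 2) / (2 * rho2 a x)) *: d_t
  - (Delta M a x / (2 * rho2 a x)) *: d_r
  + (a / (2 * rho2 a x)) *: d_phi x.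

(* A timelike vector lies in the same cone as the future null vector l iff its
   product with l is positive. *)
Definition future_timelike M a x v : Prop :=
  0 < kerr_metric M a x v v /\ 0 < kerr_metric M a x (l_field M a x) v.

Definition spacelike M a x v : Prop := kerr_metric M a x v v < 0.

(* The projection, along the timelike vector e0, onto the tangent space of the
   spacelike slice of constant t. *)
Definition spatial_part e0 v : tvector R := v - (v.1.1 / e0.1.1) *: e0.

(* (dr, v) |-> v + dr w identifies the tangent space of the slice with R^3 and
   sends (d_theta, - d_phi, d_r) to a left-handed frame, so that the positive
   frames are those with negative determinant; see positive_coordinate_frame. *)
Definition spatial_det x e1 e2 e3 : R :=
  \det (\matrix_(i < 3)
    let e := [:: e1; e2; e3]`_i in e.2 + e.1.2 *: x.2).

Definition positive_spatial_frame x e1 e2 e3 : Prop :=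
  spatial_det x e1 e2 e3 < 0.

Definition oriented_basis M a x e0 e1 e2 e3 : Prop :=
  [/\ future_timelike M a x e0,
      [/\ spacelike M a x e1, spacelike M a x e2 & spacelike M a x e3] &
      positive_spatial_frame x
        (spatial_part e0 e1) (spatial_part e0 e2) (spatial_part e0 e3)].

Definition vRe m : tvector R :=
  (complex.Re m.1.1, complex.Re m.1.2, map_mx (@complex.Re R) m.2).
Definition vIm m : tvector R :=
  (complex.Im m.1.1, complex.Im m.1.2, map_mx (@complex.Im R) m.2).
Definition vconj m : cvector R := (m.1.1^*, m.1.2^*, map_mx (@conjc R) m.2).
Definition vcomplex v : cvector R :=
  (v.1.1%:C, v.1.2%:C, map_mx (real_complex R) v.2).

(* The C-bilinear extension of g. *)
Definition ckerr_metric M a x (m m' : cvector R) : R[i] :=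
  let g := kerr_metric M a x in
  (g (vRe m) (vRe m') - g (vIm m) (vIm m'))
  +i* (g (vRe m) (vIm m') + g (vIm m) (vRe m')).

Definition oriented_tetrad M a x m : Prop :=
  let l := l_field M a x in let n := n_field M a x in
  oriented_basis M a x
    ((Num.sqrt 2)^-1 *: (l + n)) (vRe m) (- vIm m)
    ((Num.sqrt 2)^-1 *: (l - n)).

(* The total space of the bundle N_{0,r}, as a subset of T_C M. *)
Definition tetrad_bundle M a : set (event R * cvector R) :=
  [set p | let: (x, m) := p in
    let g := ckerr_metric M a x in
    [/\ exterior M a x, tangent x (vRe m), tangent x (vIm m) &
    [/\ g m m = 0,
        g (vcomplex (l_field M a x)) m = 0,
        g (vcomplex (n_field M a x)) m = 0,
        g m (vconj m) = -1 &
        oriented_tetrad M a x m]]].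

Definition continuous_section M a (s : event R -> event R * cvector R) : Prop :=
  {within exterior M a, continuous s} /\
  forall x, exterior M a x -> tetrad_bundle M a (s x) /\ (s x).1 = x.

Definition U1 : set R[i] := [set z | `|z| = 1].

Definition U1_act (p : event R * cvector R) (z : R[i]) : event R * cvector R :=
  (p.1, z *: p.2).

(* An isomorphism of principal bundles f, with inverse h, from the trivial
   bundle U(1) x M to N_{0,r}. *)
Definition trivialization M a
    (f : R[i] * event R -> event R * cvector R)
    (h : event R * cvector R -> R[i] * event R) : Prop :=
  let P := U1 `*` exterior M a in let N := tetrad_bundle M a in
  [/\ {within P, continuous f}, {within N, continuous h},
      {homo f : q / P q >-> N q}, {homo h : p / N p >-> P p} &
  [/\ forall q, P q -> h (f q) = q,
      forall p, N p -> f (h p) = p,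
      forall q, P q -> (f q).1 = q.2 &
      forall z q, U1 z -> P q -> f (z * q.1, q.2) = U1_act (f q) z]].

Definition spherical (theta phi : R) : 'rV[R]_3 :=
  vec3 (sin theta * cos phi) (sin theta * sin phi) (cos theta).

Definition d_theta (theta phi : R) : tvector R :=
  (0, 0, vec3 (cos theta * cos phi) (cos theta * sin phi) (- sin theta)).

Lemma vec3E (b0 b1 b2 : R) :
  (vec3 b0 b1 b2 0 (inord 0) = b0) * (vec3 b0 b1 b2 0 (inord 1) = b1) *
  (vec3 b0 b1 b2 0 (inord 2) = b2).
Proof. by rewrite !mxE !inordK. Qed.

Lemma dotE (v w : 'rV[R]_3) :
  dot v w = v 0 (inord 0) * w 0 (inord 0) + v 0 (inord 1) * w 0 (inord 1)
            + v 0 (inord 2) * w 0 (inord 2).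
Proof.
rewrite /dot !big_ord_recl big_ord0 addr0 addrA.
by congr (v 0 _ * w 0 _ + v 0 _ * w 0 _ + v 0 _ * w 0 _);
  apply/val_inj; rewrite /= inordK.
Qed.

Lemma kerr_metric_spherical M a (t r theta phi vt vr vtheta vphi : R) :
  let x := (t, r, spherical theta phi) in
  let v := vt *: d_t + vr *: d_r + vtheta *: d_theta theta phi
           + vphi *: d_phi x in
  let p := r ^+ 2 + a ^+ 2 * cos theta ^+ 2 in
  let D := r ^+ 2 - 2 * M * r + a ^+ 2 in
  kerr_metric M a x v v =
    (1 - 2 * M * r / p) * vt ^+ 2
  + 4 * M * a * r * sin theta ^+ 2 / p * (vt * vphi)
  - p / D * vr ^+ 2
  - p * vtheta ^+ 2
  - sin theta ^+ 2 *
      (r ^+ 2 + a ^+ 2 + 2 * M * a ^+ 2 * r * sin theta ^+ 2 / p) * vphi ^+ 2.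
Proof.
move=> x v p D.
have s2 : sin theta ^+ 2 = 1 - cos theta ^+ 2 by rewrite -(cos2Dsin2 theta); ring.
have f2 : sin phi ^+ 2 = 1 - cos phi ^+ 2 by rewrite -(cos2Dsin2 phi); ring.
have vtE : v.1.1 = vt by rewrite /v /= !scaler0 !addr0 [_%:A]mulr1.
have vrE : v.1.2 = vr by rewrite /v /= !scaler0 !addr0 add0r [_%:A]mulr1.
have v2E : v.2 = vtheta *: (d_theta theta phi).2 + vphi *: (d_phi x).2.
  by rewrite /v /= !scaler0 !add0r.
have sE : sin2_dphi x v = sin theta ^+ 2 * vphi.
  rewrite /sin2_dphi v2E dotE /= !mxE !inordK //=.
  by transitivity (sin theta ^+ 2 * (sin phi ^+ 2 + cos phi ^+ 2) * vphi);
    [ring | rewrite f2; ring].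
have dE : dot v.2 v.2 = vtheta ^+ 2 + sin theta ^+ 2 * vphi ^+ 2.
  rewrite v2E dotE /= !mxE !inordK //=.
  transitivity (vtheta ^+ 2 * (cos theta ^+ 2 * (sin phi ^+ 2 + cos phi ^+ 2)
      + sin theta ^+ 2)
    + sin theta ^+ 2 * (sin phi ^+ 2 + cos phi ^+ 2) * vphi ^+ 2); first ring.
  by rewrite f2 s2; ring.
have rE : rho2 a x = p by rewrite /rho2 /cos_theta /= vec3E.
have -> : r ^+ 2 + a ^+ 2 = p + a ^+ 2 * sin theta ^+ 2 by rewrite s2 /p; ring.
rewrite /kerr_metric vtE vrE sE dE rE /=; rewrite /Delta /= -/D.
by ring.
Qed.

Lemma spatial_detE x e1 e2 e3 :
  let c e i := e.2 0 (inord i) + e.1.2 * x.2 0 (inord i) in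
  spatial_det x e1 e2 e3 =
    c e1 0%N * (c e2 1%N * c e3 2%N - c e2 2%N * c e3 1%N)
  - c e1 1%N * (c e2 0%N * c e3 2%N - c e2 2%N * c e3 0%N)
  + c e1 2%N * (c e2 0%N * c e3 1%N - c e2 1%N * c e3 0%N).
Proof.
rewrite /spatial_det (expand_det_row _ 0) !big_ord_recl big_ord0 addr0.
rewrite /cofactor !(expand_det_row _ (0 : 'I_2)) !big_ord_recl !big_ord0 !addr0.
rewrite /cofactor !det_mx11 !mxE /= !expr0 /= /bump /= ?addn0 ?add1n ?addn1.
have e k (i : 'I_3) : nat_of_ord i = k -> i = inord k.
  by move=> <-; rewrite inord_val.
repeat match goal with
| |- context [@lift 3 (@lift 3 ?i ?j) ?k] =>
  let t := constr:(lift (lift i j) k) in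
  first [rewrite (e 0%N t erefl) | rewrite (e 1%N t erefl) | rewrite (e 2%N t erefl)]
end.
repeat match goal with
| |- context [@lift 3 ?i ?j] =>
  let t := constr:(lift i j) in
  first [rewrite (e 0%N t erefl) | rewrite (e 1%N t erefl) | rewrite (e 2%N t erefl)]
end.
by rewrite (e 0%N ord0) //; ring.
Qed.

Lemma positive_coordinate_frame (t r theta phi : R) :
  let x := (t, r, spherical theta phi) in
  0 < sin theta ->
  positive_spatial_frame x (d_theta theta phi) (- d_phi x) d_r.
Proof.
move=> x s0.
have s2 : sin theta ^+ 2 = 1 - cos theta ^+ 2 by rewrite -(cos2Dsin2 theta); ring.
have f2 : sin phi ^+ 2 = 1 - cos phi ^+ 2 by rewrite -(cos2Dsin2 phi); ring.
rewrite /positive_spatial_frame spatial_detE /= !mxE !inordK //=.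
rewrite [X in X < 0](_ : _ = - (sin theta * (cos theta ^+ 2 + sin theta ^+ 2)
   * (cos phi ^+ 2 + sin phi ^+ 2))); last by ring.
by rewrite !cos2Dsin2 !mulr1 oppr_lt0.
Qed.

End Kerr.

(* Main.v *)
Require Import Defs.
From mathcomp Require Import all_boot all_order all_algebra.
From mathcomp Require Import all_classical all_reals all_analysis.
From mathcomp Require Import ring zify.
Import Order.TTheory GRing.Theory Num.Theory.
Import numFieldNormedType.Exports.
Local Open Scope classical_set_scope.
Local Open Scope ring_scope.
Local Open Scope complex_scope.
Set Implicit Arguments.
Unset Strict Implicit.

(* Orthogonality to l and n forces dr(m) = 0 and dt(m) = a sin^2(theta) dphi(m),
   and on such vectors g is - rho^2 times the round metric of the sphere.  The
   normalization of m then makes the spherical part of Re m nonzero, so a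
   section, restricted to a sphere of constant t and r, would be a nowhere
   vanishing tangent vector field on S^2, against the hairy ball theorem.

   For the latter, expressing such a field in a frame that is continuous in
   polar coordinates, constant along theta = 0 and turning twice along
   theta = pi, gives a homotopy in the punctured plane from a constant loop to a
   loop of the form z(phi + pi / 2) = - z(phi).  Winding numbers are counted
   on a fine grid, by signed crossings of the positive real axis: they are
   invariant under the homotopy, zero for the constant loop, and twice an odd
   number for the final one, because the half-loop from phi to phi + pi is odd. *)

(** * Signed crossings and discrete winding numbers *)

Section Winding.
Variable R : realDomainType.
Implicit Types (z : R * R) (u : nat -> R * R).

(** These four open convex sets cover the punctured plane; two points of a common one are joined by
    a segment avoiding the origin. *)
Definition half_plane (h : bool * bool) : set (R * R) :=
  [set z | 0 < (-1) ^+ h.2 * (if h.1 then z.1 else z.2)].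

(** Including the positive real axis and excluding the negative one makes exactly one of [z] and
    [- z] upper when [z != 0]. *)
Definition upper z : bool := (0 < z.2) || (z.2 == 0) && (0 < z.1).

(* Signed crossing number of the edge from z to z' with the positive real axis,
   meaningful when z and z' lie in a common half-plane. *)
Definition crossing z z' : int :=
  if 0 < z.1 then (upper z')%:Z - (upper z)%:Z else 0.

Definition winding u (n : nat) : int := \sum_(k < n) crossing (u k) (u k.+1).

(** Of the four half-planes only the right one meets the positive real axis; there [crossing] is the
    coboundary of [upper]. *)
Lemma crossing_half_plane h z z' : half_plane h z -> half_plane h z' ->
  crossing z z' = if h == (true, false) then (upper z')%:Z - (upper z)%:Z else 0.
Proof.
case: h => [[] []]; rewrite /half_plane /crossing /upper /= ?expr1 ?expr0 ?mulN1r;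
  rewrite ?mul1r ?oppr_gt0.
- by move=> z0 _; rewrite ltNge ltW.
- by move=> ->.
- by move=> z0 z'0; rewrite !(ltNge 0) !(ltW z0) !(ltW z'0) !lt_eqF //= subrr if_same.
- by move=> -> ->; rewrite subrr if_same.
Qed.

Lemma crossing_square h z00 z01 z10 z11 :
  half_plane h z00 -> half_plane h z01 -> half_plane h z10 -> half_plane h z11 ->
  crossing z00 z01 + crossing z01 z11 = crossing z00 z10 + crossing z10 z11.
Proof.
move=> h00 h01 h10 h11; rewrite !(@crossing_half_plane h) //.
by case: ifP => _ //; ring.
Qed.

Lemma winding_homotopy u u' n : u n = u 0%N -> u' n = u' 0%N ->
  (forall k, (k < n)%N -> exists h, [/\ half_plane h (u k),
    half_plane h (u k.+1), half_plane h (u' k) & half_plane h (u' k.+1)]) ->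
  winding u n = winding u' n.
Proof.
move=> un u'n hp; apply/eqP; rewrite -subr_eq0 /winding -sumrB.
(* The edges joining the two loops telescope, and cancel because both loops are closed. *)
pose c k := crossing (u k) (u' k).
rewrite (eq_bigr (fun k : 'I_n => - (c k.+1 - c k))).
  rewrite sumrN -(big_mkord xpredT (fun k => c k.+1 - c k)).
  by rewrite /c telescope_sumr // un u'n subrr oppr0.
move=> k _; have [h [h1 h2 h3 h4]] := hp k (ltn_ord k).
by have := crossing_square h1 h2 h3 h4; rewrite /c; lia.
Qed.

Lemma winding_cst z n : winding (fun=> z) n = 0.
Proof.
by rewrite /winding big1 // => k _; rewrite /crossing subrr if_same.
Qed.

Lemma winding_add u m n :
  winding u (m + n) = winding u m + winding (fun k => u (m + k)%N) n.
Proof.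
by rewrite /winding big_split_ord /=; congr (_ + _); apply: eq_bigr => k _; rewrite addnS.
Qed.

Lemma upperN z : z != 0 -> upper (- z) = ~~ upper z.
Proof.
case: z => x y; rewrite /upper /= !oppr_gt0 oppr_eq0 -[0]/(0, 0) xpair_eqE.
by case: (ltgtP y 0) => //= _; case: (ltgtP x 0).
Qed.

Lemma half_planeN h z : half_plane h z -> half_plane (h.1, ~~ h.2) (- z).
Proof.
by case: h => [[] b]; rewrite /half_plane /= signrN mulrNN.
Qed.

Lemma half_plane_neq0 h z : half_plane h z -> z != 0.
Proof.
move=> hz; apply/eqP => z0; move: hz; rewrite z0 /half_plane /=.
by case: h.1; rewrite mulr0 ltxx.
Qed.

Lemma upper_half_plane h z z' :
  half_plane h z -> half_plane h z' -> ~~ h.1 -> upper z = upper z'.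
Proof.
case: h => [[] []] //; rewrite /half_plane /upper /= ?expr1 ?expr0 ?mulN1r;
  rewrite ?mul1r ?oppr_gt0.
  by move=> z0 z'0; rewrite !(ltNge 0) !(ltW z0) !(ltW z'0) !lt_eqF.
by move=> -> ->.
Qed.

(** An edge crosses the negative axis when its opposite crosses the positive one. Modulo 2 the pair
    thus counts all crossings of the real axis, that is, changes of [upper]. *)
Lemma crossingN h z z' : half_plane h z -> half_plane h z' ->
  exists q, crossing z z' + crossing (- z) (- z')
    = (upper z')%:Z - (upper z)%:Z + 2 * q.
Proof.
move=> hz hz'.
have [nz nz'] := (half_plane_neq0 hz, half_plane_neq0 hz').
rewrite (crossing_half_plane hz hz').
rewrite (crossing_half_plane (half_planeN hz) (half_planeN hz')) !upperN //.
case: h hz hz' => [[] []] /= hz hz'.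
- by exists ((upper z)%:Z - (upper z')%:Z); case: (upper z); case: (upper z').
- by exists 0; rewrite mulr0.
- by rewrite (upper_half_plane hz hz') //; exists 0; lia.
- by rewrite (upper_half_plane hz hz') //; exists 0; lia.
Qed.

(** Summed over the half-loop, [crossingN] telescopes to the change of [upper] from [u 0] to
    [u m = - u 0], which is odd. *)
Lemma winding_antiperiodic u m : (forall k, u (m + k)%N = - u k) ->
  u 0%N != 0 ->
  (forall k, (k < m)%N -> exists h, half_plane h (u k) /\ half_plane h (u k.+1)) ->
  exists q, winding u (m + m) = 1 + 2 * q.
Proof.
move=> uN u0 hp.
have sumE n : (n <= m)%N -> exists q,
    winding u n + winding (fun k => u (m + k)%N) n =
    (upper (u n))%:Z - (upper (u 0%N))%:Z + 2 * q.
  rewrite /winding -big_split /=.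
  elim: n => [_|n IH nm]; first by rewrite big_ord0; exists 0; lia.
  have [q {}IH] := IH (ltnW nm).
  have [h [hn hn1]] := hp n nm; have [q' E] := crossingN hn hn1.
  by exists (q + q'); rewrite big_ord_recr /= {}IH !uN E; ring.
have [q] := sumE m (leqnn m); rewrite -winding_add => Eq.
have := uN 0%N; rewrite addn0 => um; move: Eq; rewrite um upperN //.
by case: (upper _) => /= ->; [exists (q - 1) | exists q]; ring.
Qed.

(** The sequence has period [m + m], so the two periods contribute the same odd number. *)
Lemma winding_antiperiodic_neq0 u m : (forall k, u (m + k)%N = - u k) ->
  u 0%N != 0 ->
  (forall k, (k < m)%N -> exists h, half_plane h (u k) /\ half_plane h (u k.+1)) ->
  winding u ((m + m) + (m + m)) != 0.
Proof.
move=> uN u0 hp; have [q Eq] := winding_antiperiodic uN u0 hp.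
have -> : winding u ((m + m) + (m + m)) = winding u (m + m) + winding u (m + m).
  rewrite winding_add; congr (_ + _); apply: eq_bigr => k _.
  by rewrite -!addnA !uN !opprK.
by rewrite Eq; apply/eqP; lia.
Qed.

End Winding.

Arguments half_plane {R}.

(** * From continuous homotopies to grids *)

Section Homotopy.
Variable R : realType.
Implicit Types G : R * R -> R * R.

Lemma open_half_plane (h : bool * bool) : open (@half_plane R h).
Proof.
suff cf : continuous (fun z : R * R => (-1) ^+ h.2 * (if h.1 then z.1 else z.2)).
  by move/continuousP: cf => /(_ _ (@open_gt R 0)).
by move=> z; apply: cvgM; [exact: cvg_cst|case: h.1; [exact: cvg_fst|exact: cvg_snd]].
Qed.

Lemma neq0_half_plane (z : R * R) : z != 0 -> exists h, half_plane h z.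
Proof.
case: z => x y; rewrite -[0]/(0, 0) xpair_eqE negb_and !neq_lt => /orP[]/orP[] z0.
- by exists (true, true); rewrite /half_plane /= expr1 mulN1r oppr_gt0.
- by exists (true, false); rewrite /half_plane /= expr0 mul1r.
- by exists (false, true); rewrite /half_plane /= expr1 mulN1r oppr_gt0.
- by exists (false, false); rewrite /half_plane /= expr0 mul1r.
Qed.

(* A Lebesgue number for the covering of the square by preimages of half-planes. *)
Lemma half_plane_grid G : continuous G -> (forall p, G p != 0) ->
  exists n : nat, forall p, (`[0, 1] `*` `[0, 1]) p -> exists h, forall q,
    `|p.1 - q.1| <= n.+1%:R^-1 -> `|p.2 - q.2| <= n.+1%:R^-1 -> half_plane h (G q).
Proof.
move=> cG G0.
have : compact (`[0, 1] `*` `[0, 1] : set (R * R)).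
  by apply: compact_setX; exact: segment_compact.
move=> /compact_near_coveringP/(_ nat \oo (fun n p => exists h, forall q,
    `|p.1 - q.1| <= n.+1%:R^-1 -> `|p.2 - q.2| <= n.+1%:R^-1 -> half_plane h (G q))).
case=> [p _|n _ nP]; last by exists n => p Kp; apply: (nP n) => //=.
have [h hp] := neq0_half_plane (G0 p).
have /nbhs_ballP[e /= e0 eP] : nbhs p (G @^-1` half_plane h).
  by apply: cG; apply: open_nbhs_nbhs; split => //; exact: open_half_plane.
(* One half of [e] allows for moving [p] to [p'], the other for the grid step. *)
have e20 : 0 < e / 2 by rewrite divr_gt0.
near=> p' n; exists h => q pq1 pq2; apply: eP.
have [/= pp1 pp2] : ball p (e / 2) p' by near: p'; exact: nbhsx_ballx.
have nlt : n.+1%:R^-1 < e / 2.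
  by near: n; exact: (near_infty_natSinv_lt (PosNum e20)).
move: pp1 pp2; rewrite /ball /= => pp1 pp2.
split; rewrite /ball /= (splitr e).
  by apply: (le_lt_trans (ler_distD p'.1 _ _)); rewrite ltrD // (le_lt_trans pq1).
by apply: (le_lt_trans (ler_distD p'.2 _ _)); rewrite ltrD // (le_lt_trans pq2).
Unshelve. all: by end_near. Qed.

Lemma no_homotopy_antiperiodic G : continuous G -> (forall p, G p != 0) ->
  (forall x y, G (x, y + 1) = G (x, y)) ->
  (forall y, G (0, y) = G (0, 0)) ->
  ~ (forall y, G (1, y + 4^-1) = - G (1, y)).
Proof.
move=> cG G0 Gper G0y G1N.
have [n nP] := half_plane_grid cG G0.
(* With four times as many steps in [y], the shift by [4^-1] is exactly [m] steps; both mesh sizes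
   are at most [n.+1%:R^-1]. *)
pose m := n.+1; pose N := ((m + m) + (m + m))%N.
have m0 : m%:R != 0 :> R by rewrite pnatr_eq0.
pose u j k := G (j%:R / m%:R, k%:R / N%:R).
have NE : N%:R = 4 * m%:R :> R by rewrite /N !natrD; ring.
have uper j : u j N = u j 0%N.
  by rewrite /u mul0r -[RHS]Gper add0r divff // NE mulf_neq0.
have hp j k : (j < m)%N -> (k < N)%N -> exists h, forall j' k',
    (j <= j' <= j.+1)%N -> (k <= k' <= k.+1)%N -> half_plane h (u j' k').
  move=> jm kN.
  have [|h hP] := nP (j%:R / m%:R, k%:R / N%:R).
    by split; rewrite /= in_itv /= divr_ge0 //= ler_pdivrMr ?ltr0n // mul1r ler_nat ltnW.
  have near_grid i i' l : (m <= l)%N -> (i <= i' <= i.+1)%N ->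
      `|i%:R / l%:R - i'%:R / l%:R| <= m%:R^-1 :> R.
    move=> ml /andP[ii' i'i]; have l0 : (0 < l)%N by apply: leq_trans ml.
    rewrite -mulrBl normrM normfV (ger0_norm (ler0n _ l)) distrC ger0_norm ?subr_ge0 ?ler_nat //.
    apply: (@le_trans _ _ (1 / l%:R)).
      by rewrite ler_pM2r ?invr_gt0 ?ltr0n // lerBlDl natr1 ler_nat.
    by rewrite mul1r lef_pV2 ?posrE ?ltr0n // ler_nat.
  by exists h => j' k' jj' kk'; apply: hP => /=; apply: near_grid => //; rewrite /N; lia.
have wE j : (j <= m)%N -> winding (u j) N = winding (u 0%N) N.
  elim: j => // j IH jm; rewrite -IH ?(ltnW jm) //; apply/esym.
  apply: winding_homotopy => // k kN; have [h hP] := hp j k jm kN.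
  by exists h; split; apply: hP; rewrite !leqnn ?leqnSn.
have u0E : u 0%N = fun=> G (0, 0) by apply/funext => k; rewrite /u mul0r G0y.
have := wE m (leqnn m); rewrite u0E winding_cst => /eqP; apply/negP.
apply: winding_antiperiodic_neq0 => [k||k km].
- by rewrite /u divff // -G1N natrD addrC mulrDl; congr (G (_, _ + _)); rewrite NE; field.
- exact: G0.
(* [hp] stops before row [m = n.+1], which is the far side of the cells of row [n]. *)
- have [|h hP] := hp n k (ltnSn n); first by rewrite /N; lia.
  by exists h; split; apply: hP; rewrite !leqnn ?leqnSn.
Qed.

End Homotopy.

(** * Continuity of entries, vectors and restricted compositions *)

Lemma continuous_mxE (T : topologicalType) m n i j :
  continuous (fun A : 'M[T]_(m, n) => A i j).
Proof.
move=> A U /= AU; exists (fun i' j' => if (i' == i) && (j' == j) then U else setT).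
  by move=> i' j'; case: ifP => [/andP[/eqP-> /eqP->]|_] //; exact: filterT.
by move=> B /(_ i j); rewrite !eqxx.
Qed.

Lemma continuous_mx (S T : topologicalType) m n (f : S -> 'M[T]_(m, n)) :
  (forall i j, continuous (fun x => f x i j)) -> continuous f.
Proof.
move=> cf x U [P Px PU]; apply: filterS (fun y => PU (f y)) _.
by apply: filter_forall => i; apply: filter_forall => j; exact: cf (Px i j).
Qed.

Lemma within_continuous_precomp (S T U : topologicalType) (A : set S) (B : set T)
    (f : S -> T) (g : T -> U) :
  continuous f -> (forall x, A x -> B (f x)) -> {within B, continuous g} ->
  {within A, continuous (g \o f)}.
Proof.
move=> cf AB /subspace_continuousP cg; apply/subspace_continuousP => x Ax W gW.
have : nbhs x (fun y => B (f y) -> W (g (f y))) by exact: (cf x _ (cg _ (AB x Ax) _ gW)).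
by apply: filterS => y BW Ay; exact/BW/AB.
Qed.

Lemma continuous_complex_Re (R : realType) : continuous (@complex.Re R : R[i] -> R).
Proof.
move=> z U /nbhs_ballP[e /= e0 eU]; apply/nbhs_ballP.
exists e%:C => /=; first by rewrite ltcR.
move=> y; rewrite /ball /= => zy; apply: eU; rewrite /ball /=.
rewrite -ltcR; apply: le_lt_trans zy; rewrite -raddfB; exact: normc_ge_Re.
Qed.

Lemma continuous_pair_cst (S T : topologicalType) (c : S) :
  continuous (fun y : T => (c, y)).
Proof. by move=> y; apply: cvg_pair; [exact: cvg_cst|exact: cvg_id]. Qed.

Section Vec3.
Variables (R : realType) (T : topologicalType).
Implicit Types (f g h : T -> R).

Lemma continuous_vec3 f g h : continuous f -> continuous g -> continuous h ->
  continuous (fun p => vec3 (f p) (g p) (h p)).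
Proof.
move=> cf cg ch; apply: continuous_mx => i j.
have E k : (fun p => vec3 (f p) (g p) (h p) i k) = fun p => [:: f p; g p; h p]`_k.
  by apply/funext => p; rewrite mxE.
by case: j => [[|[|[|//]]] j3]; rewrite E.
Qed.

Lemma continuous_dot (f g : T -> 'rV[R]_3) : continuous f -> continuous g ->
  continuous (fun p => dot (f p) (g p)).
Proof.
have cE (h : T -> 'rV[R]_3) i : continuous h -> continuous (fun p => h p 0 i).
  by move=> ch p; exact: (continuous_comp (ch p) (@continuous_mxE _ _ _ 0 i (h p))).
move=> cf cg p; rewrite /dot (_ : (fun q => _) =
    fun q => f q 0 (inord 0) * g q 0 (inord 0) + f q 0 (inord 1) * g q 0 (inord 1)
             + f q 0 (inord 2) * g q 0 (inord 2)); last first.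
  by apply/funext => q; exact: dotE.
by apply: cvgD; [apply: cvgD|]; apply: cvgM; exact: cE.
Qed.

End Vec3.

(** * The hairy ball theorem on the unit sphere *)

Section HairyBall.
Variable R : realType.
Implicit Types (t f : R) (w : 'rV[R]_3) (p : R * R).

Definition unit_sphere : set 'rV[R]_3 := [set w | dot w w = 1].

Lemma unit_sphere_spherical t f : unit_sphere (spherical t f).
Proof.
rewrite /unit_sphere /spherical /= dotE !vec3E.
rewrite -[RHS](cos2Dsin2 t) -[in RHS](mulr1 (sin t ^+ 2)) -[in RHS](cos2Dsin2 f).
by ring.
Qed.

Lemma dot_eq0 w : dot w w = 0 -> w = 0.
Proof.
move=> w0; apply/rowP => i; rewrite mxE; apply/eqP; rewrite -sqrf_eq0 expr2.
by apply/eqP; move: i (erefl true); apply/psumr_eq0P: w0 => i _; rewrite -expr2 sqr_ge0.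
Qed.

(* The coordinates of w in the frame (cos f e_t - sin f e_f, sin f e_t + cos f e_f)
   of the tangent plane at [spherical t f], where e_t and e_f are the unit
   vectors along d_theta and d_phi: rotating (e_t, e_f) by the angle f makes the
   frame independent of f at the north pole t = 0, and turn twice at t = pi. *)
Definition polar_coords w t f : R * R :=
  let wt := dot w (d_theta t f).2 in
  let wf := dot w (vec3 (- sin f) (cos f) 0) in
  (cos f * wt - sin f * wf, sin f * wt + cos f * wf).

(** The frame and the radial vector are orthonormal, even at the poles, so [dot w w] is the sum of
    the squares of three vanishing coordinates. *)
Lemma polar_coords_eq0 w t f :
  dot (spherical t f) w = 0 -> polar_coords w t f = 0 -> w = 0.
Proof.
move=> tw [e1 e2]; apply: dot_eq0.
have c2 := cos2Dsin2 t; have f2 := cos2Dsin2 f.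
pose wt := dot w (d_theta t f).2; pose wf := dot w (vec3 (- sin f) (cos f) 0).
(* Undoing the rotation by the angle [f] recovers [wt], and likewise [wf] below. *)
have wt0 : wt = 0.
  rewrite -[wt]mul1r -f2; transitivity (cos f * (cos f * wt - sin f * wf)
    + sin f * (sin f * wt + cos f * wf)); first ring.
  by rewrite e1 e2 !mulr0 addr0.
have wf0 : wf = 0.
  rewrite -[wf]mul1r -f2; transitivity (cos f * (sin f * wt + cos f * wf)
    - sin f * (cos f * wt - sin f * wf)); first ring.
  by rewrite e1 e2 !mulr0 subr0.
transitivity (wt ^+ 2 + wf ^+ 2 + dot (spherical t f) w ^+ 2); last first.
  by rewrite wt0 wf0 tw !expr0n !addr0.
rewrite /wt /wf !dotE /= !vec3E.
set x := w 0 _; set y := w 0 _; set z := w 0 _.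
transitivity ((cos f ^+ 2 + sin f ^+ 2) * (x ^+ 2 + y ^+ 2) + z ^+ 2).
  by rewrite f2; ring.
transitivity ((cos t ^+ 2 + sin t ^+ 2) * ((x * cos f + y * sin f) ^+ 2 + z ^+ 2)
  + (y * cos f - x * sin f) ^+ 2).
  by rewrite c2; ring.
by ring.
Qed.

Lemma spherical0 f : spherical 0 f = vec3 0 0 1.
Proof. by rewrite /spherical sin0 cos0 !mul0r. Qed.

Lemma spherical_pi f : spherical pi f = vec3 0 0 (-1).
Proof. by rewrite /spherical sinpi cospi !mul0r. Qed.

Lemma polar_coords_north w f : polar_coords w 0 f = (w 0 (inord 0), w 0 (inord 1)).
Proof.
rewrite /polar_coords /= !dotE !vec3E sin0 cos0.
set x := w 0 (inord 0); set y := w 0 (inord 1); have f2 := cos2Dsin2 f.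
transitivity ((cos f ^+ 2 + sin f ^+ 2) * x, (cos f ^+ 2 + sin f ^+ 2) * y).
  by congr (_, _); ring.
by rewrite f2 !mul1r.
Qed.

(** At the south pole the frame is (-cos 2f, -sin 2f, 0), (-sin 2f, cos 2f, 0), which a quarter turn
    of [f] reverses. *)
Lemma polar_coords_south w f : polar_coords w pi (f + pi / 2) = - polar_coords w pi f.
Proof.
rewrite /polar_coords /= !dotE !vec3E sinpi cospi cosDpihalf sinDpihalf.
by apply: (f_equal2 pair) => /=; ring.
Qed.

Theorem hairy_ball (v : 'rV[R]_3 -> 'rV[R]_3) :
  {within unit_sphere, continuous v} ->
  (forall w, unit_sphere w -> dot w (v w) = 0) ->
  exists2 w, unit_sphere w & v w = 0.
Proof.
move=> cv tv; apply: contrapT => v0.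
(* As [p.1] goes from 0 to 1 a meridian is run from pole to pole; one unit of [p.2] is a full turn
   in longitude. *)
pose t p : R := pi * p.1; pose f p : R := 2 * pi * p.2.
pose G p := polar_coords (v (spherical (t p) (f p))) (t p) (f p).
have ct : continuous t.
  by move=> p; apply: cvgM; [exact: cvg_cst|exact: cvg_fst].
have cf : continuous f.
  by move=> p; apply: cvgM; [exact: cvg_cst|exact: cvg_snd].
have ccos h : continuous h -> continuous (fun p : R * R => cos (h p) : R).
  by move=> ch p; apply: continuous_comp; [exact: ch|exact: continuous_cos].
have csin h : continuous h -> continuous (fun p : R * R => sin (h p) : R).
  by move=> ch p; apply: continuous_comp; [exact: ch|exact: continuous_sin].
have cM (g h : R * R -> R) : continuous g -> continuous h -> continuous (fun p => g p * h p).
  by move=> cg ch p; apply: cvgM; [exact: cg|exact: ch].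
have cN (h : R * R -> R) : continuous h -> continuous (fun p => - h p).
  by move=> ch p; apply: cvgN; exact: ch.
have [[[cct cst] ccf] csf] := (ccos _ ct, csin _ ct, ccos _ cf, csin _ cf).
have cV : continuous (fun p => v (spherical (t p) (f p))).
  have cs : continuous (fun p => spherical (t p) (f p)).
    by apply: continuous_vec3 => //; exact: cM.
  (* [v] is continuous only relative to the sphere, where [spherical] takes all its values. *)
  move=> p; apply: cvg_comp; last first.
    exact: (iffLR (subspace_continuousP _ _) cv _ (unit_sphere_spherical (t p) (f p))).
  move=> U WU.
  have : nbhs p (fun q => unit_sphere (spherical (t q) (f q)) ->
                          U (spherical (t q) (f q))) by exact: (cs p _ WU).
  by apply: filterS => q; apply; exact: unit_sphere_spherical.
have cE : continuous (fun p => dot (v (spherical (t p) (f p))) (d_theta (t p) (f p)).2).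
  rewrite /d_theta /=; apply: continuous_dot => //.
  by apply: continuous_vec3; [exact: cM|exact: cM|exact: cN].
have cP : continuous (fun p =>
    dot (v (spherical (t p) (f p))) (vec3 (- sin (f p)) (cos (f p)) 0)).
  apply: continuous_dot => //; apply: continuous_vec3 => //; first exact: cN.
  by move=> p; exact: cvg_cst.
have cG : continuous G.
  have c1 : continuous (fun p => (G p).1).
    by move=> p; apply: cvgB; [exact: (cM _ _ ccf cE)|exact: (cM _ _ csf cP)].
  have c2 : continuous (fun p => (G p).2).
    by move=> p; apply: cvgD; [exact: (cM _ _ csf cE)|exact: (cM _ _ ccf cP)].
  by move=> p; exact: (cvg_pair (c1 p) (c2 p)).
apply: (@no_homotopy_antiperiodic R G) => //.
- move=> p; apply/eqP => /polar_coords_eq0 Gp; apply: v0.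
  have S := unit_sphere_spherical (t p) (f p).
  by exists (spherical (t p) (f p)) => //; apply: Gp; exact: tv.
- move=> x y; have fE : f (x, y + 1) = f (x, y) + pi *+ 2.
    by rewrite /f /= -mulr_natl; ring.
  by rewrite /G /polar_coords /spherical /d_theta fE cosD2pi sinD2pi.
- by move=> y; rewrite /G /t /= mulr0 !spherical0 !polar_coords_north.
- move=> y; have fE : f (1, y + 4^-1) = f (1, y) + pi / 2 by rewrite /f /=; field.
  by rewrite /G fE /t /= mulr1 !spherical_pi polar_coords_south.
Qed.

End HairyBall.

Arguments unit_sphere {R}.

(** * The Kerr metric and its principal null directions *)

Section KerrTetrad.
Variables (R : realType) (M a : R).
Hypotheses (a_gt0 : 0 < a) (a_lt_M : a < M).
Implicit Types (x : event R) (u v : tvector R) (m : cvector R).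

Lemma outer_radius_gt0 : 0 < outer_radius M a.
Proof. by rewrite ltr_wpDr ?sqrtr_ge0 // (lt_trans a_gt0). Qed.

Lemma Delta_gt0 x : exterior M a x -> 0 < Delta M a x.
Proof.
case; rewrite /outer_radius -ltrBrDl => rx _.
have s0 : 0 <= M ^+ 2 - a ^+ 2 by rewrite subr_ge0 ler_sqr ?nnegrE ltW // (lt_trans a_gt0).
have := sqr_sqrtr s0; have := sqrtr_ge0 (M ^+ 2 - a ^+ 2).
rewrite /Delta; move: (Num.sqrt _) rx => q rx q0 qE.
(* Completing the square reduces the claim to [q < x.1.2 - M], with [q] the square root in
   [outer_radius]. *)
rewrite (_ : _ + _ = (x.1.2 - M) ^+ 2 - (M ^+ 2 - a ^+ 2)); last by ring.
by rewrite -qE subr_gt0 ltr_sqr ?nnegrE // (le_trans q0) // ltW.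
Qed.

Lemma rho2_gt0 x : exterior M a x -> 0 < rho2 a x.
Proof.
case=> rx _; apply: ltr_pwDl; last by rewrite mulr_ge0 ?sqr_ge0.
by rewrite exprn_gt0 // (lt_trans outer_radius_gt0 rx).
Qed.

Lemma kerr_metric0l x v : kerr_metric M a x 0 v = 0.
Proof.
by rewrite /kerr_metric /sin2_dphi !dotE /= !mxE; ring.
Qed.

Lemma kerr_metricNr x u v : kerr_metric M a x u (- v) = - kerr_metric M a x u v.
Proof.
by rewrite /kerr_metric /sin2_dphi !dotE /= !mxE; ring.
Qed.

Lemma sin2_dphi_d_phi x : exterior M a x ->
  sin2_dphi x (d_phi x) = 1 - cos_theta x ^+ 2.
Proof.
by case=> _; rewrite /sin2_dphi /cos_theta !dotE !vec3E => <-; ring.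
Qed.

(** Both [l_field] and [n_field] have this shape, without a theta component, so [v.2] enters only
    through [sin2_dphi x v]. *)
Lemma kerr_metric_adapted_frame x (b c d : R) v : exterior M a x ->
  let p := rho2 a x in let r := x.1.2 in
  let S := 1 - cos_theta x ^+ 2 in let s := sin2_dphi x v in
  kerr_metric M a x (b *: d_t R + c *: d_r R + d *: d_phi x) v =
    (1 - 2 * M * r / p) * b * v.1.1
  + 2 * M * a * r / p * (b * s + v.1.1 * (d * S))
  - p / Delta M a x * c * v.1.2 - p * d * s
  - a ^+ 2 * (1 + 2 * M * r / p) * (d * S) * s.
Proof.
move=> ex p r S s; set u := (X in kerr_metric _ _ _ X).
have ut : u.1.1 = b by rewrite /u /= !scaler0 !addr0 [_%:A]mulr1.
have ur : u.1.2 = c by rewrite /u /= !scaler0 add0r addr0 [_%:A]mulr1.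
have u2 : u.2 = d *: (d_phi x).2 by rewrite /u /= !scaler0 !add0r.
have us : sin2_dphi x u = d * S.
  rewrite /S -sin2_dphi_d_phi // /sin2_dphi u2 !dotE !mxE; ring.
have ud : dot u.2 v.2 = d * s by rewrite u2 /s /sin2_dphi !dotE !mxE; ring.
by rewrite /kerr_metric us ut ur ud -/p -/r -/s; ring.
Qed.

Lemma kerr_metric_l x v : exterior M a x ->
  kerr_metric M a x (l_field M a x) v =
  v.1.1 - a * sin2_dphi x v - rho2 a x / Delta M a x * v.1.2.
Proof.
move=> ex; rewrite /l_field -[d_r R]scale1r kerr_metric_adapted_frame //=.
have := lt0r_neq0 (Delta_gt0 ex); have := lt0r_neq0 (rho2_gt0 ex).
rewrite /rho2 /Delta; move: (sin2_dphi x v) (cos_theta x) x.1.2 => s c r p0 D0.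
by field; rewrite D0 exprMn p0.
Qed.

Lemma kerr_metric_n x v : exterior M a x ->
  kerr_metric M a x (n_field M a x) v =
  Delta M a x / (2 * rho2 a x) * (v.1.1 - a * sin2_dphi x v) + v.1.2 / 2.
Proof.
move=> ex; rewrite /n_field -scaleNr kerr_metric_adapted_frame //=.
have := lt0r_neq0 (Delta_gt0 ex); have := lt0r_neq0 (rho2_gt0 ex).
rewrite /rho2 /Delta; move: (sin2_dphi x v) (cos_theta x) x.1.2 => s c r p0 D0.
by field; rewrite D0 exprMn p0.
Qed.

Lemma kerr_metric_orthogonal x v : exterior M a x ->
  kerr_metric M a x (l_field M a x) v = 0 ->
  kerr_metric M a x (n_field M a x) v = 0 ->
  kerr_metric M a x v v = - rho2 a x * dot v.2 v.2.
Proof.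
move=> ex; rewrite kerr_metric_l // kerr_metric_n // => /eqP; rewrite subr_eq0 => /eqP E.
have D0 := lt0r_neq0 (Delta_gt0 ex); have p0 := lt0r_neq0 (rho2_gt0 ex).
(* Once [E] is inserted, both terms of the equation from [n_field] equal [v.1.2 / 2]. *)
rewrite E => vr; have {vr} vr : v.1.2 = 0.
  by rewrite -[RHS]vr; field; rewrite p0 D0.
move: E; rewrite vr mulr0 => /eqP; rewrite subr_eq0 => /eqP vt.
(* After this substitution the coefficients of [sin2_dphi x v ^+ 2] add up to zero. *)
by rewrite /kerr_metric vt vr /=; ring.
Qed.

(** * Complex tetrads and sections of the bundle *)

Lemma vRe_complex v : vRe (vcomplex v) = v.
Proof.
case: v => [[vt vr] w]; rewrite /vRe /vcomplex /=; congr (_, _).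
by apply/matrixP => i j; rewrite !mxE.
Qed.

Lemma vIm_complex v : vIm (vcomplex v) = 0.
Proof.
case: v => [[vt vr] w]; rewrite /vIm /vcomplex /=; congr (_, _).
by apply/matrixP => i j; rewrite !mxE.
Qed.

Lemma vRe_conj m : vRe (vconj m) = vRe m.
Proof.
case: m => [[[? ?] [? ?]] w]; rewrite /vRe /vconj /=; congr (_, _).
by apply/matrixP => i j; rewrite !mxE; case: (w i j).
Qed.

Lemma vIm_conj m : vIm (vconj m) = - vIm m.
Proof.
case: m => [[[? ?] [? ?]] w]; rewrite /vIm /vconj /=; congr (_, _).
by apply/matrixP => i j; rewrite !mxE; case: (w i j).
Qed.

Lemma ckerr_metric_eq0 x v m : ckerr_metric M a x (vcomplex v) m = 0 ->
  kerr_metric M a x v (vRe m) = 0 /\ kerr_metric M a x v (vIm m) = 0.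
Proof.
rewrite /ckerr_metric vRe_complex vIm_complex !kerr_metric0l subr0 addr0 => E.
by split; [exact: (congr1 (@complex.Re R) E)|exact: (congr1 (@complex.Im R) E)].
Qed.

(** The real parts of g(m, m) = 0 and g(m, conj m) = -1 are the difference and the sum of the norms
    of Re m and Im m, so both norms are -1/2. A zero sphere component would make that of Re m
    vanish, by [kerr_metric_orthogonal]. *)
Lemma tetrad_bundle_Re_neq0 x m : tetrad_bundle M a (x, m) -> (vRe m).2 <> 0.
Proof.
case=> ex _ _ [mm /ckerr_metric_eq0[lR lI] /ckerr_metric_eq0[nR nI] mc _] m0.
have := congr1 (@complex.Re R) mm; have := congr1 (@complex.Re R) mc.
rewrite /= vRe_conj vIm_conj kerr_metricNr !kerr_metric_orthogonal // m0.
rewrite (_ : dot 0 0 = 0) ?dotE ?mxE ?mulr0 ?addr0 // opprK sub0r add0r => -> /eqP.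
by rewrite opprK oner_eq0.
Qed.

Lemma no_continuous_section : ~ exists s, continuous_section M a s.
Proof.
move=> [s [cs sP]].
(* An arbitrary sphere of constant t and r inside the exterior. *)
pose e (w : 'rV[R]_3) : event R := (0, outer_radius M a + 1, w).
have ce : continuous e by exact: continuous_pair_cst.
have eE w : unit_sphere w -> exterior M a (e w) by move=> w1; split => //=; rewrite ltrDl.
pose v w := (vRe (s (e w)).2).2.
have cv : {within unit_sphere, continuous v}.
  have cse : {within unit_sphere, continuous (s \o e)}.
    exact: (within_continuous_precomp ce eE cs).
  apply: continuous_mx => i j.
  have c22 : continuous (fun p : event R * cvector R => p.2.2).
    by move=> p; apply: (@cvg_comp _ _ _ snd snd); exact: cvg_snd.
  have cRe : continuous (fun p : event R * cvector R => complex.Re (p.2.2 i j)).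
    move=> p; apply: (continuous_comp _ (@continuous_complex_Re R _)).
    exact: (continuous_comp (c22 p) (@continuous_mxE _ _ _ i j _)).
  rewrite (_ : (fun y => v y i j) =
    (fun p : event R * cvector R => complex.Re (p.2.2 i j)) \o (s \o e)).
    by move=> w; exact: (continuous_comp (cse w) (cRe _)).
  by apply/funext => y; rewrite /v /= mxE.
have [w w1 vw] : exists2 w, unit_sphere w & v w = 0.
  (* The bundle gives tangency at the base point of [s (e w)], which is [e w] since [s] is a
     section. *)
  apply: hairy_ball => // w /eE /sP[]; rewrite [s _]surjective_pairing => -[_ tw _ _] /= sw.
  by move: tw; rewrite sw.
have [] := sP _ (eE w w1); rewrite [s _]surjective_pairing => sw _.
exact: tetrad_bundle_Re_neq0 sw vw.
Qed.

(** The unit section of the trivial bundle is carried to a section. *)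
Lemma trivialization_section f h : trivialization M a f h ->
  continuous_section M a (fun x => f (1, x)).
Proof.
case=> cf _ fN _ [_ _ f1 _].
have P1 x : exterior M a x -> (@U1 R `*` exterior M a) (1, x).
  by split => //=; rewrite /U1 /= normr1.
split => [|x /P1 Px]; last by split; [exact: fN|exact: f1].
exact: within_continuous_precomp (@continuous_pair_cst _ _ _) P1 cf.
Qed.

End KerrTetrad.

Unset Implicit Arguments.
Set Strict Implicit.

Theorem proposition3p1 (R : realType) (M a : R) (ha : 0 < a) (haM : a < M) :
  ~ (exists s : event R -> event R * cvector R, continuous_section M a s) /\
  ~ (exists (f : R[i] * event R -> event R * cvector R)
            (h : event R * cvector R -> R[i] * event R), trivialization M a f h).
Proof.
split=> [|[f [h /trivialization_section fs]]]; first exact: no_continuous_section.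
by apply: (no_continuous_section ha haM); exists (fun x => f (1, x)).
Qed.
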